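(* Let $\rho>0$, let $Y_0\in\mathbb{R}^{m\times n}$, and let $X_k,Y_k,Z_k$ be generated, for $k=0,1,2,\dots$, by $$X_{k+1}=[Y_k-\rho C]_+,\qquad Z_{k+1}=\mathsf{P}_{\mathcal{X}}(2X_{k+1}-Y_k),\qquad Y_{k+1}=Y_k+Z_{k+1}-X_{k+1}.$$ Then for every $k\ge 0$ and any $X\in\mathbb{R}_+^{m\times n}$, $Z\in\mathcal{X}$ and $Y\in\mathbb{R}^{m\times n}$, $$V\big(X_{k+1},Z_{k+1},(Y-Z)/\rho\big)-V\big(X,Z,(Y_k-X_{k+1})/\rho\big)\le \frac{1}{2\rho}\|Y_k-Y\|^2-\frac{1}{2\rho}\|Y_{k+1}-Y\|^2 .$$ Furthermore, let $Y^\star$ be a fixed point of $T$ and let $X^\star=[Y^\star-\rho C]_+$ be the solution of the optimal transport problem defined from $Y^\star$. Then for every $k\ge 1$, $$\langle C,\bar X_k\rangle-\langle C,X^\star\rangle\le \frac1k\left(\frac{1}{2\rho}\|Y_0\|^2+\frac{2}{\rho}\|X^\star\|\,\|Y_0-Y^\star\|\right),$$ $$\|\bar Z_k-\bar X_k\|=\frac{\|Y_k-Y_0\|}{k}\le\frac{2\|Y_0-Y^\star\|}{k},$$ where $\bar X_k=\frac1k\sum_{i=1}^k X_i$ and $\bar Z_k=\frac1k\sum_{i=1}^k Z_i$.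
   Context: Let $m,n\ge 1$, $C\in\mathbb{R}_+^{m\times n}$, and let $p\in\mathbb{R}_+^m$, $q\in\mathbb{R}_+^n$ be probability vectors (entries summing to $1$). Let $e=\mathbf{1}_n$, $f=\mathbf{1}_m$ be the all-ones vectors. The optimal transport problem is to minimize $\langle C,X\rangle$ over $X\in\mathbb{R}^{m\times n}$ subject to $X\ge 0$ entrywise, $Xe=p$, $X^\top f=q$. Here $\langle X,Y\rangle=\mathrm{tr}(X^\top Y)$ and $\|\cdot\|$ is the induced Frobenius norm. $\mathcal{X}=\{X\in\mathbb{R}^{m\times n}: Xe=p,\ X^\top f=q\}$, $\mathsf{P}_{\mathcal{X}}$ is the Euclidean (Frobenius) projection onto $\mathcal{X}$, and $[X]_+=\max(X,0)$ entrywise. The map $T:\mathbb{R}^{m\times n}\to\mathbb{R}^{m\times n}$ is $T(Y)=Y+\mathsf{P}_{\mathcal{X}}\big(2[Y-\rho C]_+-Y\big)-[Y-\rho C]_+$ (so $Y_{k+1}=T(Y_k)$). The function $V$ is defined for $X\in\mathbb{R}_+^{m\times n}$, $Z\in\mathcal{X}$, $U\in\mathbb{R}^{m\times n}$ by $V(X,Z,U)=F(X)+G_0(Z)+\langle U,Z-X\rangle$, where $F(X)=\langle C,X\rangle+\mathsf{I}_{\mathbb{R}_+^{m\times n}}(X)$, $G_0(Z)=\mathsf{I}_{\mathcal{X}}(Z)$, and $\mathsf{I}_S$ denotes the indicator function ($0$ on $S$, $+\infty$ off $S$); thus on this domain $V(X,Z,U)=\langle C,X\rangle+\langle U,Z-X\rangle$.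 *)

(* Defs.v *)
From HB Require Import structures.
From mathcomp Require Import all_boot all_order all_algebra.
From mathcomp Require Import all_classical all_reals.

Set Implicit Arguments.
Unset Strict Implicit.
Unset Printing Implicit Defensive.

Import Order.TTheory GRing.Theory Num.Theory.

Local Open Scope classical_set_scope.
Local Open Scope ring_scope.

Definition inner (R : realType) (m n : nat) (X Y : 'M[R]_(m, n)) : R :=
  \tr (X^T *m Y).

(* The norm induced by [inner]; the canonical norm [`|X|] that MathComp-Analysis
   puts on matrices is the max norm, hence this separate definition. *)
Definition frob (R : realType) (m n : nat) (X : 'M[R]_(m, n)) : R :=
  Num.sqrt (inner X X).

Definition pos_part (R : realType) (m n : nat) (X : 'M[R]_(m, n)) :
  'M[R]_(m, n) := map_mx (fun x => Num.max x 0) X.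

Definition nonneg_mx (R : realType) (m n : nat) : set 'M[R]_(m, n) :=
  [set X | forall i j, 0 <= X i j].

Definition prob_vec (R : realType) (m : nat) (p : 'cV[R]_m) : Prop :=
  (forall i, 0 <= p i 0) /\ \sum_i p i 0 = 1.

(* The affine set {X | X e = p, X^T f = q}, without the sign constraint. *)
Definition marginals (R : realType) (m n : nat) (p : 'cV[R]_m) (q : 'cV[R]_n) :
  set 'M[R]_(m, n) :=
  [set X | X *m const_mx 1 = p /\ X^T *m const_mx 1 = q].

Definition ot_feasible (R : realType) (m n : nat)
    (p : 'cV[R]_m) (q : 'cV[R]_n) : set 'M[R]_(m, n) :=
  @nonneg_mx R m n `&` marginals p q.

Definition ot_solution (R : realType) (m n : nat) (C : 'M[R]_(m, n))
    (p : 'cV[R]_m) (q : 'cV[R]_n) (X : 'M[R]_(m, n)) : Prop :=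
  ot_feasible p q X /\
  forall W, ot_feasible p q W -> inner C X <= inner C W.

Definition is_proj (R : realType) (m n : nat) (S : set 'M[R]_(m, n))
    (Y P : 'M[R]_(m, n)) : Prop :=
  S P /\ forall W, S W -> frob (P - Y) <= frob (W - Y).

(* A point of [S] nearest to [Y]; the default value [Y] is used only when no
   nearest point exists, which cannot happen for a nonempty affine [S]. *)
Definition frob_proj (R : realType) (m n : nat) (S : set 'M[R]_(m, n))
    (Y : 'M[R]_(m, n)) : 'M[R]_(m, n) :=
  xget Y [set P | is_proj S Y P].

Definition dr_map (R : realType) (m n : nat) (C : 'M[R]_(m, n))
    (p : 'cV[R]_m) (q : 'cV[R]_n) (rho : R) (Y : 'M[R]_(m, n)) :
  'M[R]_(m, n) :=
  Y + frob_proj (marginals p q) (2 *: pos_part (Y - rho *: C) - Y)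
    - pos_part (Y - rho *: C).

Definition convex_indic (R : realType) (T : Type) (S : set T) (x : T) : \bar R :=
  if x \in S then 0%E else +oo%E.

Definition objF (R : realType) (m n : nat) (C X : 'M[R]_(m, n)) : \bar R :=
  ((inner C X)%:E + convex_indic R (@nonneg_mx R m n) X)%E.

Definition objG (R : realType) (m n : nat) (p : 'cV[R]_m) (q : 'cV[R]_n)
    (Z : 'M[R]_(m, n)) : \bar R :=
  convex_indic R (marginals p q) Z.

Definition lagrangian (R : realType) (m n : nat) (C : 'M[R]_(m, n))
    (p : 'cV[R]_m) (q : 'cV[R]_n) (X Z U : 'M[R]_(m, n)) : \bar R :=
  (objF C X + objG p q Z + (inner U (Z - X))%:E)%E.

(* The mean of the terms of index 1, ..., k; the term of index 0 is left out. *)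
Definition ergodic (R : realType) (m n : nat) (X : nat -> 'M[R]_(m, n))
    (k : nat) : 'M[R]_(m, n) :=
  k%:R^-1 *: \sum_(1 <= i < k.+1) X i.

(* Main.v *)
Require Import Defs.
From HB Require Import structures.
From mathcomp Require Import all_boot all_order all_algebra.
From mathcomp Require Import all_classical all_reals.
From mathcomp Require Import ring lra.

Set Implicit Arguments.
Unset Strict Implicit.
Unset Printing Implicit Defensive.

Import Order.TTheory GRing.Theory Num.Theory.

Local Open Scope ring_scope.


(** Write [d] for [Z_(k+1) - X_(k+1)], so that [Y_(k+1) = Y_k + d].  Two
    variational characterizations drive everything.  As [X_(k+1)] is the nearest
    nonnegative matrix to [Y_k - rho C], the inner product of
    [Y_k - rho C - X_(k+1)] with [X - X_(k+1)] is at most 0 for every nonnegative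
    [X] ([inner_pos_part]).  As [Z_(k+1)] is the orthogonal projection of
    [2 X_(k+1) - Y_k] on an affine set, the residual is orthogonal to
    [Z - Z_(k+1)] for every [Z] of that set ([proj_marginals]).  Expanding
    squares, the right side of the one-step inequality minus its left side is, up
    to the factor [2 rho], the squared norm of [d] minus twice the first of these
    inner products minus twice the second, hence nonnegative ([dr_step]).

    At a fixed point [Ystar] the projection of [2 Xstar - Ystar] is [Xstar], so
    the same two characterizations hold with [Xstar] in both roles.  Added up,
    they say that [(Xstar, Xstar)] minimizes the Lagrangian with multiplier
    [(Ystar - Xstar) / rho].  Three consequences follow.
    - On pairs [(W, W)] with [W] feasible the multiplier term vanishes, hence
      [Xstar] is optimal.
    - The one-step inequality at [X = Z = Xstar], [Y = Ystar] has a nonnegative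
      left side, so the distance from [Y_k] to [Ystar] does not increase; hence
      [Y_k] is within twice the distance from [Y_0] to [Ystar] of [Y_0].
    - The one-step inequality at [X = Z = Xstar], [Y = 0] can be summed: the
      increments [d] telescope to [Y_k - Y_0] and the squared norms telescope
      as well, leaving the norm of [Y_0] squared over [2 rho] and the inner
      product of [Xstar] with [Y_k - Y_0], which Cauchy-Schwarz and the previous
      bound control.  Linearity of the cost turns the mean of the costs into the
      cost of the mean. *)

(** * The Frobenius inner product *)

Section Inner.
Variables (R : realType) (m n : nat).
Implicit Types A B D : 'M[R]_(m, n).

Lemma innerE A B : inner A B = \sum_i \sum_j A i j * B i j.
Proof.
rewrite /inner /mxtrace exchange_big /=; apply: eq_bigr => j _.
by rewrite mxE; apply: eq_bigr => i _; rewrite mxE.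
Qed.

Lemma innerC A B : inner A B = inner B A.
Proof. by rewrite /inner -mxtrace_tr trmx_mul trmxK. Qed.

Lemma innerDl A B D : inner (A + B) D = inner A D + inner B D.
Proof. by rewrite /inner linearD mulmxDl mxtraceD. Qed.

Lemma innerNl A D : inner (- A) D = - inner A D.
Proof. by rewrite /inner !linearN /= mulNmx linearN. Qed.

Lemma innerZl a A D : inner (a *: A) D = a * inner A D.
Proof. by rewrite /inner linearZ /= -scalemxAl mxtraceZ. Qed.

Lemma innerDr D A B : inner D (A + B) = inner D A + inner D B.
Proof. by rewrite innerC innerDl !(innerC D). Qed.

Lemma innerNr D A : inner D (- A) = - inner D A.
Proof. by rewrite innerC innerNl (innerC D). Qed.

Lemma innerZr a D A : inner D (a *: A) = a * inner D A.
Proof. by rewrite innerC innerZl (innerC D). Qed.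

Definition inner_expand :=
  (innerDl, innerDr, innerNl, innerNr, innerZl, innerZr).

Lemma inner0r D : inner D 0 = 0.
Proof. by rewrite -(scale0r D) innerZr mul0r. Qed.

Lemma inner_sumr D (I : Type) (r : seq I) (F : I -> 'M[R]_(m, n)) :
  inner D (\sum_(i <- r) F i) = \sum_(i <- r) inner D (F i).
Proof. exact: (big_morph (inner D) (innerDr D) (inner0r D)). Qed.

Lemma inner_ge0 A : 0 <= inner A A.
Proof.
rewrite innerE; apply: sumr_ge0 => i _; apply: sumr_ge0 => j _.
by rewrite -expr2 sqr_ge0.
Qed.

Lemma inner_eq0 A : inner A A = 0 -> A = 0.
Proof.
rewrite innerE => /eqP.
have ge0 i j : 0 <= A i j * A i j by rewrite -expr2 sqr_ge0.
rewrite psumr_eq0 => [/allP A0|i _]; last exact: sumr_ge0.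
apply/matrixP => i j; move: (A0 i (mem_index_enum i)).
rewrite /= psumr_eq0 // => /allP /(_ j (mem_index_enum j)).
by rewrite /= mxE mulf_eq0 orbb => /eqP.
Qed.

Lemma frob_ge0 A : 0 <= frob A.
Proof. exact: sqrtr_ge0. Qed.

Lemma frob_sq A : frob A ^+ 2 = inner A A.
Proof. by rewrite sqr_sqrtr // inner_ge0. Qed.

Lemma ler_frob A B : (frob A <= frob B) = (inner A A <= inner B B).
Proof. by rewrite ler_psqrt // nnegrE inner_ge0. Qed.

Lemma frobN A : frob (- A) = frob A.
Proof. by rewrite /frob innerNl innerNr opprK. Qed.

Lemma frobZ a A : 0 <= a -> frob (a *: A) = a * frob A.
Proof.
move=> a0; rewrite /frob innerZl innerZr mulrA -expr2.
by rewrite sqrtrM ?sqr_ge0 // sqrtr_sqr ger0_norm.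
Qed.

(** Cauchy-Schwarz, from the squared norm of [frob B *: A - frob A *: B]. *)
Lemma inner_le_frob A B : inner A B <= frob A * frob B.
Proof.
have := inner_ge0 (frob B *: A - frob A *: B).
have := frob_sq A; have := frob_sq B.
have [/inner_eq0 -> _ _ _|A0] := eqVneq (inner A A) 0.
  by rewrite innerC inner0r mulr_ge0 ?frob_ge0.
have [/inner_eq0 -> _ _ _|B0] := eqVneq (inner B B) 0.
  by rewrite inner0r mulr_ge0 ?frob_ge0.
have a0 : 0 < frob A by rewrite sqrtr_gt0 lt0r A0 inner_ge0.
have b0 : 0 < frob B by rewrite sqrtr_gt0 lt0r B0 inner_ge0.
move=> eB eA; rewrite !inner_expand (innerC B A) -eA -eB => h.
have ab0 : 0 < frob A * frob B by exact: mulr_gt0.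
rewrite -(ler_pM2l ab0); lra.
Qed.

Lemma ler_frobD A B : frob (A + B) <= frob A + frob B.
Proof.
have h : 0 <= frob A + frob B by rewrite addr_ge0 ?frob_ge0.
rewrite -(ler_pXn2r (ltn0Sn 1)) ?nnegrE ?frob_ge0 //.
rewrite sqrrD !frob_sq !inner_expand (innerC B A).
have := inner_le_frob A B; lra.
Qed.

End Inner.

(** * Projections on the nonnegative matrices and on the marginal constraints *)

Section Projections.
Variables (R : realType) (m n : nat).
Implicit Types X Y W P : 'M[R]_(m, n).

Lemma pos_part_ge0 Y : nonneg_mx (pos_part Y).
Proof. by move=> i j; rewrite mxE le_max lexx orbT. Qed.

(** Entrywise, either the residual [Y - pos_part Y] is 0, or [pos_part Y] is 0 and
    the residual is nonpositive while [X] is nonnegative. *)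
Lemma inner_pos_part Y X :
  nonneg_mx X -> inner (Y - pos_part Y) (X - pos_part Y) <= 0.
Proof.
move=> X0; rewrite innerE; apply: sumr_le0 => i _; apply: sumr_le0 => j _.
rewrite !mxE; have := X0 i j; case: (leP (Y i j) 0) => h x0; nra.
Qed.

(** Pythagoras: the squared distance from [Y] to a point [W] of [S] is the squared
    distance from [P] to [W] plus a constant, so [P] is the unique nearest point
    and [frob_proj] has no other choice. *)
Lemma frob_proj_orth (S : set 'M[R]_(m, n)) Y P :
  S P -> (forall W, S W -> inner (Y - P) (W - P) = 0) -> frob_proj S Y = P.
Proof.
move=> SP orth.
have pyth W : S W ->
    inner (W - Y) (W - Y) = inner (W - P) (W - P) + inner (P - Y) (P - Y).
  move=> /orth; rewrite !inner_expand (innerC Y W) (innerC P W) (innerC P Y).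
  lra.
apply: xget_unique => /= [|Q [SQ minQ]].
  split=> // W SW; rewrite ler_frob (pyth W SW).
  by rewrite lerDr inner_ge0.
apply/eqP; rewrite -subr_eq0; apply/eqP/inner_eq0/eqP.
rewrite eq_le inner_ge0 andbT.
by move: (minQ P SP); rewrite ler_frob (pyth Q SQ) gerDr.
Qed.

Lemma marginalsP (p : 'cV[R]_m) (q : 'cV[R]_n) X :
  marginals p q X <->
  (forall i, \sum_j X i j = p i 0) /\ (forall j, \sum_i X i j = q j 0).
Proof.
have rowE i : (X *m const_mx 1 : 'cV_m) i 0 = \sum_j X i j.
  by rewrite mxE; apply: eq_bigr => j _; rewrite mxE mulr1.
have colE j : (X^T *m const_mx 1 : 'cV_n) j 0 = \sum_i X i j.
  by rewrite mxE; apply: eq_bigr => i _; rewrite !mxE mulr1.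
split=> [[rX cX]|[rX cX]]; split.
- by move=> i; rewrite -rowE rX.
- by move=> j; rewrite -colE cX.
- by apply/colP => i; rewrite rowE.
- by apply/colP => j; rewrite colE.
Qed.

Section Marginals.
Variables (p : 'cV[R]_m) (q : 'cV[R]_n).
Hypotheses (m_gt0 : (0 < m)%N) (n_gt0 : (0 < n)%N).
Hypothesis pq : \sum_i p i 0 = \sum_j q j 0.

(** The normal space of the marginal constraints consists of the matrices
    [u i + v j], so the projection has to be [Y] plus such a matrix.  Spreading
    the row defects over the [n] columns and the column defects over the [m] rows
    counts the total defect [s] twice; the term [s / (m * n)] takes it away. *)
Lemma marginals_correction Y : exists (u : 'I_m -> R) (v : 'I_n -> R),
  marginals p q (\matrix_(i, j) (Y i j + (u i + v j))).
Proof.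
have m0 : m%:R != 0 :> R by rewrite pnatr_eq0 -lt0n.
have n0 : n%:R != 0 :> R by rewrite pnatr_eq0 -lt0n.
have sum_const l (c : R) : \sum_(i < l) c = c * l%:R.
  by rewrite sumr_const card_ord mulr_natr.
pose s := \sum_j (q j 0 - \sum_i Y i j).
have sE : s = \sum_i (p i 0 - \sum_j Y i j).
  by rewrite /s !big_split /= !sumrN exchange_big /= pq.
exists (fun i => (p i 0 - \sum_j Y i j) / n%:R - s / (m%:R * n%:R)).
exists (fun j => (q j 0 - \sum_i Y i j) / m%:R).
apply/marginalsP; split=> [i|j].
  under eq_bigr => j _ do rewrite mxE.
  rewrite big_split /= big_split /= -mulr_suml -/s sum_const.
  by field; rewrite m0.
under eq_bigr => i _ do rewrite mxE.
rewrite big_split /= big_split /= big_split /= -mulr_suml -sE !sum_const.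
by field; rewrite m0.
Qed.

Lemma proj_marginals Y :
  marginals p q (frob_proj (marginals p q) Y) /\
  forall W, marginals p q W ->
    inner (Y - frob_proj (marginals p q) Y)
          (W - frob_proj (marginals p q) Y) = 0.
Proof.
have [u [v]] := marginals_correction Y; set P := \matrix_(i, j) _ => SP.
have orth W : marginals p q W -> inner (Y - P) (W - P) = 0.
  have /marginalsP [rP cP] := SP => /marginalsP [rW cW].
  have r0 i : \sum_j (W - P) i j = 0.
    under eq_bigr => j _ do rewrite 2!mxE.
    by rewrite big_split /= sumrN rW rP subrr.
  have c0 j : \sum_i (W - P) i j = 0.
    under eq_bigr => i _ do rewrite 2!mxE.
    by rewrite big_split /= sumrN cW cP subrr.
  have YP i j : (Y - P) i j = - u i - v j by rewrite !mxE; ring.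
  rewrite innerE.
  under eq_bigr => i _ do
    (under eq_bigr => j _ do rewrite YP mulrDl;
     rewrite big_split /= -mulr_sumr r0 mulr0 add0r).
  (* The row part [u] is gone; the column part [v] needs the column sums. *)
  rewrite exchange_big big1 //= => j _.
  by rewrite -mulr_sumr c0 mulr0.
by rewrite (frob_proj_orth SP orth).
Qed.

End Marginals.
End Projections.

(** * One step of the iteration *)

Section Step.
Variables (R : realType) (m n : nat).
Implicit Types C X Y Z : 'M[R]_(m, n).

Lemma lagrangianE C (p : 'cV[R]_m) (q : 'cV[R]_n) X Z U :
  nonneg_mx X -> marginals p q Z ->
  lagrangian C p q X Z U = (inner C X + inner U (Z - X))%:E.
Proof.
move=> X0 Zpq; rewrite /lagrangian /objF /objG /convex_indic.
by rewrite !ifT ?inE // !adde0.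
Qed.

(** The two hypotheses are the optimality conditions of the two half steps.  Up to
    the factor [2 * rho], the gap between the two sides is the squared norm of
    [Z1 - X1] minus twice each of the two inner products; the identity [slack]
    below records this without any division. *)
Lemma dr_step C (rho : R) Y X1 Z1 X' Z' Y' :
  0 < rho ->
  inner (Y - rho *: C - X1) (X' - X1) <= 0 ->
  inner (2 *: X1 - Y - Z1) (Z' - Z1) = 0 ->
  inner C X1 + inner (rho^-1 *: (Y' - Z')) (Z1 - X1)
  - (inner C X' + inner (rho^-1 *: (Y - X1)) (Z' - X'))
  <= (2 * rho)^-1 * frob (Y - Y') ^+ 2
     - (2 * rho)^-1 * frob (Y + Z1 - X1 - Y') ^+ 2.
Proof.
move=> rho0 hX hZ.
set gap := inner (Z1 - X1) (Z1 - X1)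
  - 2 * inner (Y - rho *: C - X1) (X' - X1)
  - 2 * inner (2 *: X1 - Y - Z1) (Z' - Z1).
have slack :
    inner (Y - Y') (Y - Y') - inner (Y + Z1 - X1 - Y') (Y + Z1 - X1 - Y')
    - 2 * (rho * (inner C X1 - inner C X') + inner (Y' - Z') (Z1 - X1)
           - inner (Y - X1) (Z' - X')) = gap.
  rewrite /gap !inner_expand.
  (* [ring] does not know that [inner] is symmetric. *)
  rewrite (innerC Z1 X1) (innerC Z1 Y) (innerC Z1 Y') (innerC X1 Y).
  rewrite (innerC X1 Y') (innerC Y' Y) (innerC Z' X1) (innerC Z' Z1).
  ring.
rewrite !frob_sq !innerZl -subr_ge0.
set lhs := (X in 0 <= X); have -> : lhs = (2 * rho)^-1 * gap.
  by rewrite -slack /lhs; field; rewrite gt_eqF.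
apply: mulr_ge0; first by rewrite invr_ge0; lra.
have := inner_ge0 (Z1 - X1); rewrite /gap hZ; lra.
Qed.

Lemma ergodicE (X : nat -> 'M[R]_(m, n)) k :
  ergodic X k = k%:R^-1 *: \sum_(i < k) X i.+1.
Proof. by rewrite /ergodic big_add1 /= big_mkord. Qed.

End Step.

(** * Ergodic rates *)

Theorem theorem1 (R : realType) (m n : nat) (hm : (1 <= m)%N) (hn : (1 <= n)%N)
    (C : 'M[R]_(m, n)) (hC : nonneg_mx C)
    (p : 'cV[R]_m) (hp : prob_vec p) (q : 'cV[R]_n) (hq : prob_vec q)
    (rho : R) (hrho : 0 < rho)
    (X Y Z : nat -> 'M[R]_(m, n))
    (hX : forall k, X k.+1 = pos_part (Y k - rho *: C))
    (hZ : forall k, Z k.+1 = frob_proj (marginals p q) (2 *: X k.+1 - Y k))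
    (hY : forall k, Y k.+1 = Y k + Z k.+1 - X k.+1) :
  (forall (k : nat) (X' Z' Y' : 'M[R]_(m, n)),
     nonneg_mx X' -> marginals p q Z' ->
     (lagrangian C p q (X k.+1) (Z k.+1) (rho^-1 *: (Y' - Z'))
        - lagrangian C p q X' Z' (rho^-1 *: (Y k - X k.+1))
      <= ((2 * rho)^-1 * frob (Y k - Y') ^+ 2
          - (2 * rho)^-1 * frob (Y k.+1 - Y') ^+ 2)%:E)%E)
  /\
  (forall Ystar Xstar : 'M[R]_(m, n),
     dr_map C p q rho Ystar = Ystar ->
     Xstar = pos_part (Ystar - rho *: C) ->
     ot_solution C p q Xstar /\
     forall k : nat, (1 <= k)%N ->
       [/\ inner C (ergodic X k) - inner C Xstar
             <= k%:R^-1 * ((2 * rho)^-1 * frob (Y 0%N) ^+ 2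
                           + 2 / rho * frob Xstar * frob (Y 0%N - Ystar)),
           frob (ergodic Z k - ergodic X k) = frob (Y k - Y 0%N) / k%:R
         & frob (Y k - Y 0%N) / k%:R <= 2 * frob (Y 0%N - Ystar) / k%:R]).
Proof.
have rho_neq0 : rho != 0 by rewrite gt_eqF.
have pq : \sum_i p i 0 = \sum_j q j 0 by rewrite hp.2 hq.2.
have projP := proj_marginals hm hn pq.
have X0 k : nonneg_mx (X k.+1) by rewrite hX; exact: pos_part_ge0.
have Zpq k : marginals p q (Z k.+1) by rewrite hZ; exact: (projP _).1.
have varX k W : nonneg_mx W ->
    inner (Y k - rho *: C - X k.+1) (W - X k.+1) <= 0.
  by rewrite hX; exact: inner_pos_part.
have varZ k W : marginals p q W ->
    inner (2 *: X k.+1 - Y k - Z k.+1) (W - Z k.+1) = 0.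
  by rewrite hZ; apply: (projP _).2.
have step k X' Z' Y' : nonneg_mx X' -> marginals p q Z' ->
    inner C (X k.+1) + inner (rho^-1 *: (Y' - Z')) (Z k.+1 - X k.+1)
    - (inner C X' + inner (rho^-1 *: (Y k - X k.+1)) (Z' - X'))
    <= (2 * rho)^-1 * frob (Y k - Y') ^+ 2
       - (2 * rho)^-1 * frob (Y k.+1 - Y') ^+ 2.
  by move=> X'0 Z'pq; rewrite hY; apply: dr_step => //; [exact: varX|exact: varZ].
split=> [k X' Z' Y' X'0 Z'pq|Ys Xs fixYs XsE].
  by rewrite !lagrangianE // -EFinB lee_fin; exact: step.
have projXs : frob_proj (marginals p q) (2 *: Xs - Ys) = Xs.
  apply/eqP; rewrite -subr_eq0; apply/eqP/(addrI Ys).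
  by rewrite addr0 addrA -[RHS]fixYs /dr_map -XsE.
have Xs0 : nonneg_mx Xs by rewrite XsE; exact: pos_part_ge0.
have [Xspq orthXs] := projP (2 *: Xs - Ys); rewrite projXs in Xspq orthXs.
(* [(Xs, Xs)] minimizes the Lagrangian with multiplier [(Ys - Xs) / rho]. *)
have dual W V : nonneg_mx W -> marginals p q V ->
    inner C Xs <= inner C W + rho^-1 * inner (Ys - Xs) (V - W).
  move=> W0 Vpq; have := inner_pos_part (Ys - rho *: C) W0; rewrite -XsE => h1.
  have h2 := orthXs V Vpq.
  rewrite -(ler_pM2l hrho) mulrDr mulrA mulfV // mul1r.
  move: h1 h2; rewrite !inner_expand.
  lra.
split.
  split; first by split.
  by move=> W [W0 Wpq]; have := dual W W W0 Wpq; rewrite subrr inner0r mulr0 addr0.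
(* The iterates never move away from the fixed point. *)
have fejer k : frob (Y k - Ys) <= frob (Y 0%N - Ys).
  elim: k => // k IH; apply: le_trans IH.
  have := step k Xs Xs Ys Xs0 Xspq; have := dual _ _ (X0 k) (Zpq k).
  rewrite subrr inner0r addr0 innerZl => h1 h2.
  rewrite ler_frob -!frob_sq.
  have r2 : 0 < (2 * rho)^-1 by rewrite invr_gt0; lra.
  rewrite -(ler_pM2l r2); lra.
have drift k : frob (Y k - Y 0%N) <= 2 * frob (Y 0%N - Ys).
  have -> : Y k - Y 0%N = (Y k - Ys) + - (Y 0%N - Ys) by rewrite opprB addrA subrK.
  by apply: le_trans (ler_frobD _ _) _; rewrite frobN; have := fejer k; lra.
have telescope k : \sum_(i < k) (Z i.+1 - X i.+1) = Y k - Y 0%N.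
  elim: k => [|k IH]; first by rewrite big_ord0 subrr.
  by rewrite big_ord_recr /= IH hY addrAC addrA.
move=> k k0.
have k_gt0 : 0 < k%:R :> R by rewrite ltr0n.
split.
- (* Choosing 0 for the free matrix leaves only [Xs] against the telescoping
     increments of [Y]. *)
  have sums l : \sum_(i < l) (inner C (X i.+1) - inner C Xs)
      <= rho^-1 * inner Xs (Y l - Y 0%N)
         + ((2 * rho)^-1 * frob (Y 0%N) ^+ 2 - (2 * rho)^-1 * frob (Y l) ^+ 2).
    elim: l => [|l IH]; first by rewrite big_ord0 !subrr inner0r mulr0 addr0.
    rewrite big_ord_recr /=.
    have := step l Xs Xs 0 Xs0 Xspq.
    have YD : Y l.+1 - Y 0%N = (Y l - Y 0%N) + (Z l.+1 - X l.+1).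
      by rewrite -!telescope big_ord_recr.
    rewrite subrr inner0r !addr0 sub0r innerZl innerNl !subr0 YD.
    rewrite (innerDr Xs (Y l - _)).
    lra.
  rewrite ergodicE innerZr inner_sumr.
  have -> : k%:R^-1 * (\sum_(i < k) inner C (X i.+1)) - inner C Xs
      = k%:R^-1 * \sum_(i < k) (inner C (X i.+1) - inner C Xs).
    rewrite big_split /= sumr_const card_ord -mulr_natr.
    by field; rewrite gt_eqF.
  rewrite ler_pM2l ?invr_gt0 //; apply: le_trans (sums k) _.
  have cs := inner_le_frob Xs (Y k - Y 0%N).
  have bd := ler_wpM2l (frob_ge0 Xs) (drift k).
  have ri : 0 <= rho^-1 by rewrite invr_ge0 ltW.
  have := ler_wpM2l ri (le_trans cs bd).
  have : 0 <= (2 * rho)^-1 * frob (Y k) ^+ 2.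
    by rewrite mulr_ge0 ?sqr_ge0 // invr_ge0; lra.
  lra.
- rewrite !ergodicE -scalerBr -sumrB telescope frobZ ?invr_ge0 ?ltW //.
  exact: mulrC.
- by rewrite ler_pM2r ?invr_gt0.
Qed.
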